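(* Let $\alpha\in(0,1)$, $B=\alpha/2$, $h>0$, $\eta_n=nh$ for integers $n\ge0$, and let $U:[0,\infty)\to[0,\infty)$ be bounded and sufficiently smooth ($C^1$ for the rectangle quadrature, $C^2$ for the trapezoid quadrature). Set $N=\gamma n$, where $$\gamma=\begin{cases}[h^{-B}]+1, & \text{rectangle quadrature},\\ [h^{-2B}]+1, & \text{trapezoid quadrature},\end{cases}$$ and $[\cdot]$ denotes the integer part. Then for every $n\ge0$, $$\big|F_\alpha U(\eta_n)-\widehat F_{\alpha,N}U(\eta_n)\big|\le\begin{cases}\Big(\max_{z\ge\eta_N}|U(z)|+\max_{0\le z\le\eta_N}|U'(z)|\Big)\dfrac{h}{\Gamma(2-\alpha)}, & \text{rectangle quadrature},\\[2mm] \Big(\max_{z\ge\eta_N}|U(z)|+\tfrac12\max_{0\le z\le\eta_N}|U''(z)|\Big)\dfrac{h^2}{\Gamma(2-\alpha)}, & \text{trapezoid quadrature},\end{cases}$$ where $\widehat F_{\alpha,N}$ is the corresponding (rectangle or trapezoid) discretization defined in the context, and a maximum over an unbounded set is understood as a supremum.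
   Context: Erdélyi–Kober operator: $F_\alpha U(\eta)=\frac{1}{\Gamma(1-\alpha)}\int_0^1(1-s)^{-\alpha}U(s^{-B}\eta)\,ds$. In particular $F_\alpha U(0)=U(0)/\Gamma(2-\alpha)$, and for $n\ge1$ (substituting $z=s^{-B}\eta_n$) $$F_\alpha U(\eta_n)=\frac{\eta_n^{(1-\alpha)/B}}{B\,\Gamma(1-\alpha)}\int_{\eta_n}^\infty\big(\eta_n^{-1/B}-z^{-1/B}\big)^{-\alpha}z^{-1/B-1}U(z)\,dz.$$ Discretization: for $n=0$, $\widehat F_{\alpha,N}U(0)=U(0)/\Gamma(2-\alpha)$. For $n\ge1$ and $N>n$, the integral is truncated at $\eta_N=Nh$ and $U$ is replaced by an interpolant on each cell: $$\widehat F_{\alpha,N}U(\eta_n)=\frac{\eta_n^{(1-\alpha)/B}}{B\,\Gamma(1-\alpha)}\sum_{i=n}^{N-1}\int_{\eta_i}^{\eta_{i+1}}\big(\eta_n^{-1/B}-z^{-1/B}\big)^{-\alpha}z^{-1/B-1}\,\Pi_iU(z)\,dz,$$ where for the rectangle quadrature $\Pi_iU(z)=U(\eta_{i+1})$, and for the trapezoid quadrature $\Pi_iU(z)=U(\eta_i)+\frac{U(\eta_{i+1})-U(\eta_i)}{h}(z-\eta_i)$. (For the rectangle quadrature this is $\sum_{i=n+1}^N a_{in}U(\eta_i)$ with $a_{in}=\frac{1}{\Gamma(2-\alpha)}\big[(1-(i/n)^{-1/B})^{1-\alpha}-(1-((i-1)/n)^{-1/B})^{1-\alpha}\big]$.)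 *)

(* Defs.v *)
From HB Require Import structures.
From mathcomp Require Import all_boot all_order all_algebra.
From mathcomp Require Import all_classical all_reals all_analysis.

Set Implicit Arguments.
Unset Strict Implicit.
Unset Printing Implicit Defensive.

Import Order.TTheory GRing.Theory Num.Theory.
Import numFieldNormedType.Exports.

Local Open Scope classical_set_scope.
Local Open Scope ring_scope.

(* Functions on the half-line [0, +oo[ are represented by total functions
   R -> R; no definition below inspects their values at negative points. *)

Section half_line.
Context {R : realType}.
Implicit Types (U : R -> R) (x y : R).

(* The filter of difference quotients only sees y >= 0, so that at x = 0 the
   derivative is the right-hand one. *)
Definition diff_quot0y U x : set_system R :=
  (U y - U x) / (y - x) @[y --> within `[0, +oo[ x^'].

Definition derive0y U x : R := lim (diff_quot0y U x).

Definition C1_0y U : Prop :=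
  (forall x, 0 <= x -> cvg (diff_quot0y U x)) /\
  {within `[0, +oo[, continuous (derive0y U)}.

Definition C2_0y U : Prop := C1_0y U /\ C1_0y (derive0y U).

End half_line.

Section erdelyi_kober.
Context {R : realType}.
Implicit Types (U : R -> R) (alpha B h eta x z : R) (n N i : nat).

(* Euler's integral, meaningful for 0 < x. *)
Definition Gamma x : R :=
  \int[lebesgue_measure]_(t in `]0, +oo[) (t `^ (x - 1) * expR (- t)).

(* The integrals below are over open intervals because their integrands are
   singular at an endpoint, where [powR] takes the junk value 0 `^ a = 0. *)
Definition EK alpha B U eta : R :=
  (Gamma (1 - alpha))^-1 *
  \int[lebesgue_measure]_(s in `]0, 1[)
     ((1 - s) `^ (- alpha) * U (s `^ (- B) * eta)).

Definition node h i : R := i%:R * h.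

Definition rectangle h U i z : R := U (node h i.+1).

Definition trapezoid h U i z : R :=
  U (node h i) + (U (node h i.+1) - U (node h i)) / h * (z - node h i).

Definition EK_discr (Pi : R -> (R -> R) -> nat -> R -> R)
    alpha B h N U n : R :=
  if n == 0%N then U 0 / Gamma (2 - alpha)
  else node h n `^ ((1 - alpha) / B) / (B * Gamma (1 - alpha)) *
    \sum_(n <= i < N)
      \int[lebesgue_measure]_(z in `]node h i, node h i.+1[)
        ((node h n `^ (- B^-1) - z `^ (- B^-1)) `^ (- alpha) *
         z `^ (- B^-1 - 1) * Pi h U i z).

(* For real sets [sup] is the least upper bound when the set is nonempty and
   bounded above. *)
Definition sup_norm (A : set R) (f : R -> R) : R := sup [set `|f z| | z in A].

Definition gamma_rect B h : nat := (Num.truncn (h `^ (- B))).+1.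

Definition gamma_trap B h : nat := (Num.truncn (h `^ (- (2 * B)))).+1.

End erdelyi_kober.

(* Main.v *)
Require Import Defs.
From HB Require Import structures.
From mathcomp Require Import all_boot all_order all_algebra.
From mathcomp Require Import all_classical all_reals all_analysis.
From mathcomp Require Import measurable_realfun ring lra.

Set Implicit Arguments.
Unset Strict Implicit.
Unset Printing Implicit Defensive.

Import Order.TTheory GRing.Theory Num.Theory.
Import numFieldNormedType.Exports.

Local Open Scope classical_set_scope.
Local Open Scope ring_scope.

(** The substitution [s = (z / eta) ^ (-1/B)], with [eta = node h n], turns the
    truncated and discretized integral into
    [\int_(s_N < s < 1) (1 - s) ^ (-alpha) * Pi(s) ds], where [s_N = (N / n) ^
    (-1/B)], so that both operators integrate against the same weight
    [(1 - s) ^ (-alpha)], whose total mass is [1 / (1 - alpha)]. The error then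
    has two sources.

    - Truncation: on [0 < s < s_N] the argument of [U] exceeds [node h N].
      Since the weight increases with [s], its mass there is at most
      [s_N / (1 - alpha)] ([Rintegral_weight_0x]), and the ratio [N / n] is the
      least integer above [h ^ (-p B)], which is exactly what makes
      [s_N <= h ^ p], with [p] the order of the quadrature
      ([powRN_inv_le_powR]).
    - Interpolation: a uniform bound [eps] on [U - Pi U] costs at most [eps]
      times the mass of the weight on [s_N < s < 1]. The bound is the mean
      value theorem for rectangles, and [linear_interpolation_error] for
      trapezoids.

    The recurrence [Gamma (2 - alpha) = (1 - alpha) * Gamma (1 - alpha)]
    ([GammaD1]) merges [1 / (1 - alpha)] with the normalizing constant; the sum
    of the two contributions is [quadrature_error], which holds for every
    nonnegative interpolation rule. At [n = 0] both operators agree ([EK0]).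

    For [n >= 1] the nodes involved are positive, so the one-sided derivative at
    the origin enters only through the supremum norms.

    The weight and the substituted integrands are singular at an endpoint.
    Classical calculus on segments is therefore carried over to open
    intervals by exhausting them with segments, nonnegativity of the integrands
    giving monotone convergence. *)

(** * Calculus on open intervals by exhaustion *)

Section exhaustion.
Context {R : realType}.
Notation mu := (@lebesgue_measure R).
Implicit Types (f F G : R -> R) (a b : R) (u v : R^nat) (A : set R).

Lemma segment_exhaustion_cvg u v A f :
  {homo u : m n / (m <= n)%N >-> n <= m} ->
  {homo v : m n / (m <= n)%N >-> m <= n} ->
  \bigcup_k `[u k, v k]%classic = A -> open A ->
  {in A, continuous f} -> (forall x, A x -> 0 <= f x) ->
  (\int[mu]_(x in `[u k, v k]) (f x)%:E)%E @[k --> \oo] -->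
  (\int[mu]_(x in A) (f x)%:E)%E.
Proof.
move=> u_noninc v_nondec uvA oA cf f_ge0.
have uv_sub k : `[u k, v k]%classic `<=` A by move=> x ukx; rewrite -uvA; exists k.
rewrite -uvA; apply: ge0_nondecreasing_set_cvg_integral => //.
- move=> m n mn; rewrite subsetEset; apply: subset_itv; rewrite bnd_simp.
    exact: u_noninc.
  exact: v_nondec.
- move=> k; apply/measurable_EFinP.
  apply: (@measurable_funS _ _ _ _ A) => //; first exact: open_measurable.
  exact: open_continuous_measurable_fun.
- by move=> k x /uv_sub Ax; rewrite lee_fin f_ge0.
Qed.

(** The offset 3 in the denominators makes each segment nondegenerate, even for
    [k = 0]. *)
Definition lseq a b : R^nat := fun k => a + (b - a) / k.+3%:R.
Definition rseq a b : R^nat := fun k => b - (b - a) / k.+3%:R.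

Section lrseq.
Variables (a b : R).
Hypothesis ab : a < b.

Lemma lseq_noninc : {homo lseq a b : m n / (m <= n)%N >-> n <= m}.
Proof.
move=> m n mn; rewrite /lseq lerD2l ler_pM2l ?subr_gt0//.
by rewrite lef_pV2 ?posrE// ler_nat !ltnS.
Qed.

Lemma rseq_nondec : {homo rseq a b : m n / (m <= n)%N >-> m <= n}.
Proof.
move=> m n mn; rewrite /rseq lerD2l lerN2 ler_pM2l ?subr_gt0//.
by rewrite lef_pV2 ?posrE// ler_nat !ltnS.
Qed.

Lemma lseq_gt k : a < lseq a b k.
Proof. by rewrite /lseq ltrDl divr_gt0// subr_gt0. Qed.

Lemma rseq_lt k : rseq a b k < b.
Proof. by rewrite /rseq gtrDl oppr_lt0 divr_gt0// subr_gt0. Qed.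

Lemma lseq_lt_rseq k : lseq a b k < rseq a b k.
Proof.
rewrite /lseq /rseq ltrBrDr -addrA -ltrBrDl -mulrDr.
rewrite gtr_pMr ?subr_gt0// -mulr2n -(mulr_natr _ 2) mulrC.
by rewrite ltr_pdivrMr// mul1r ltr_nat.
Qed.

Lemma cvg_lseq : lseq a b k @[k --> \oo] --> a.
Proof.
rewrite -[X in _ --> X]addr0; apply: cvgD; first exact: cvg_cst.
rewrite -[X in _ --> X](mulr0 (b - a)); apply: cvgMr.
have := @cvg_harmonic R; rewrite -(cvg_shiftn 2)/=.
by under [X in X @ _ --> _]eq_fun do rewrite /harmonic/= addn2.
Qed.

Lemma cvg_rseq : rseq a b k @[k --> \oo] --> b.
Proof.
rewrite -[X in _ --> X]subr0; apply: cvgB; first exact: cvg_cst.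
rewrite -[X in _ --> X](mulr0 (b - a)); apply: cvgMr.
have := @cvg_harmonic R; rewrite -(cvg_shiftn 2)/=.
by under [X in X @ _ --> _]eq_fun do rewrite /harmonic/= addn2.
Qed.

Lemma lrseq_bigcup : \bigcup_k `[lseq a b k, rseq a b k]%classic = `]a, b[%classic.
Proof.
apply/seteqP; split => x /=.
  move=> [k _] /=; rewrite !in_itv/= => /andP[lx xr].
  by rewrite (lt_le_trans (lseq_gt k))//= (le_lt_trans xr)// rseq_lt.
rewrite in_itv/= => /andP[ax xb].
have [k _ lk] : \forall k \near \oo, lseq a b k <= x.
  by apply: (cvgr_le _ cvg_lseq).
have [l _ rl] : \forall k \near \oo, x <= rseq a b k.
  by apply: (cvgr_ge _ cvg_rseq).
exists (maxn k l) => //=; rewrite in_itv/= lk ?rl//=.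
  exact: leq_maxr.
exact: leq_maxl.
Qed.

End lrseq.

Lemma subseg_oo a b k : a < b ->
  forall x, x \in `[lseq a b k, rseq a b k] -> x \in `]a, b[.
Proof.
move=> ab x; rewrite !in_itv/= => /andP[lx xr].
by rewrite (lt_le_trans (lseq_gt ab k))//= (le_lt_trans xr)// rseq_lt.
Qed.

Lemma lseq_oo a b k : a < b -> lseq a b k \in `]a, b[.
Proof.
move=> ab; apply: (@subseg_oo _ _ k) => //.
by rewrite in_itv/= lexx ltW// lseq_lt_rseq.
Qed.

Lemma rseq_oo a b k : a < b -> rseq a b k \in `]a, b[.
Proof.
move=> ab; apply: (@subseg_oo _ _ k) => //.
by rewrite in_itv/= lexx ltW// lseq_lt_rseq.
Qed.

(** The integrand may blow up at the endpoints: only the primitive has to extend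
    continuously to the closed interval. *)
Lemma ge0_continuous_FTC2_oo f F a b : a < b ->
  {in `]a, b[, forall x, 0 <= f x} -> {in `]a, b[, continuous f} ->
  {in `]a, b[, forall x : R, is_derive x 1 F (f x)} ->
  {within `[a, b], continuous F} ->
  (\int[mu]_(x in `]a, b[) (f x)%:E = (F b - F a)%:E)%E.
Proof.
move=> ab f_ge0 cf dF /(continuous_within_itvP _ ab)[_ Fa Fb].
have seg_int k : (\int[mu]_(x in `[lseq a b k, rseq a b k]) (f x)%:E =
    (F (rseq a b k) - F (lseq a b k))%:E)%E.
  have lr := lseq_lt_rseq ab k.
  have dFk x : x \in `[lseq a b k, rseq a b k] -> derivable F x 1.
    by move=> /(subseg_oo ab)/dF[].
  have [_ Fl Fr] : [/\ {in `]lseq a b k, rseq a b k[, continuous F},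
      F x @[x --> (lseq a b k)^'+] --> F (lseq a b k) &
      F x @[x --> (rseq a b k)^'-] --> F (rseq a b k)].
    exact/(continuous_within_itvP _ lr)/derivable_within_continuous.
  rewrite EFinB; apply: continuous_FTC2 => //.
  - apply: continuous_in_subspaceT => x; rewrite inE/= => /(subseg_oo ab).
    exact: cf.
  - split => // x xlr; apply: dFk; exact: subset_itv_oo_cc xlr.
  - move=> x xlr; rewrite derive1E.
    have /(subseg_oo ab)/dF dFx := subset_itv_oo_cc xlr.
    exact: derive_val.
have intk : (\int[mu]_(x in `[lseq a b k, rseq a b k]) (f x)%:E)%E
    @[k --> \oo] --> (\int[mu]_(x in `]a, b[) (f x)%:E)%E.
  apply: segment_exhaustion_cvg.
  - exact: lseq_noninc.
  - exact: rseq_nondec.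
  - exact: lrseq_bigcup.
  - exact: interval_open.
  - by move=> x; rewrite inE => /cf.
  - by move=> x /f_ge0.
apply: (cvg_unique _ intk) => //=.
under eq_fun do rewrite seg_int.
apply: cvg_EFin; first exact: nearW.
apply: cvgB.
- move/cvg_at_leftP : Fb; apply; split; first exact: rseq_lt.
  exact: cvg_rseq.
- move/cvg_at_rightP : Fa; apply; split; first exact: lseq_gt.
  exact: cvg_lseq.
Qed.

(** Both sides are limits of the same integrals over segments. The images of the
    segments exhaust the target interval by the intermediate value theorem. *)
Lemma decreasing_ge0_substitution_oo F f G a b : a < b ->
  {in `[a, b] &, {homo F : x y /~ (x < y)%R}} ->
  {in `]a, b[, forall x : R, is_derive x 1 F (f x)} ->
  {in `]a, b[, continuous f} ->
  {within `[a, b], continuous F} ->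
  {in `]F b, F a[, continuous G} -> {in `]F b, F a[, forall y, 0 <= G y} ->
  (\int[mu]_(y in `]F b, F a[) (G y)%:E =
   \int[mu]_(x in `]a, b[) (G (F x) * - f x)%:E)%E.
Proof.
move=> ab decrF dF cf cF cG G_ge0.
have F_oo x : x \in `]a, b[ -> F x \in `]F b, F a[.
  move=> xab; have := xab; rewrite !in_itv/= => /andP[ax xb].
  by rewrite !decrF// ?(subset_itv_oo_cc xab)// in_itv/= lexx ltW.
have F_le x y : x \in `]a, b[ -> y \in `]a, b[ -> x <= y -> F y <= F x.
  move=> xab yab; rewrite le_eqVlt => /predU1P[->//|xy].
  by rewrite ltW// decrF// subset_itv_oo_cc.
have F'f : {in `]a, b[, derive1 F =1 f}.
  by move=> x /dF dFx; rewrite derive1E; exact: derive_val.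
have f_le0 x : x \in `]a, b[ -> f x <= 0.
  move=> xab; rewrite -F'f//; apply: (@decr_derive1_le0 _ _ `]a, b[%classic).
  - by rewrite interior_itv => y; rewrite inE/= => /dF[].
  - move=> y z; rewrite !inE/= => yab zab; apply: decrF; exact: subset_itv_oo_cc.
  - by rewrite interior_itv.
have cFx x : x \in `]a, b[ -> {for x, continuous F}.
  by move=> /dF[dFx _]; exact/differentiable_continuous/derivable1_diffP.
pose l := lseq a b; pose r := rseq a b.
have seg_int k : (\int[mu]_(y in `[F (r k), F (l k)]) (G y)%:E =
    \int[mu]_(x in `[l k, r k]) (G (F x) * - f x)%:E)%E.
  have lr : l k < r k := lseq_lt_rseq ab k.
  have lrab x : x \in `[l k, r k] -> x \in `]a, b[ by exact: subseg_oo.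
  have dFk x : x \in `[l k, r k] -> derivable F x 1.
    by move=> /lrab/dF[].
  have [_ Fl Fr] : [/\ {in `]l k, r k[, continuous F},
      F x @[x --> (l k)^'+] --> F (l k) &
      F x @[x --> (r k)^'-] --> F (r k)].
    exact/(continuous_within_itvP _ lr)/derivable_within_continuous.
  have cF' x : x \in `]a, b[ -> {for x, continuous (derive1 F)}.
    move=> xab; apply: (@cvg_trans _ (f z @[z --> x])).
      apply: near_eq_cvg; near=> z; rewrite F'f//.
      by near: z; exact: near_in_itvoo.
    by rewrite F'f//; exact: cf.
  rewrite integration_by_substitution_decreasing//; last 7 first.
  - exact: ltW.
  - by move=> x y xlr ylr; apply: decrF; apply: subset_itv_oo_cc; exact: lrab.
  - by move=> x /subset_itv_oo_cc/lrab/cF'.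
  - apply: (cvgP (derive1 F (l k))); apply: cvg_at_right_filter.
    exact/cF'/lseq_oo.
  - apply: (cvgP (derive1 F (r k))); apply: cvg_at_left_filter.
    exact/cF'/rseq_oo.
  - split => // x xlr; apply: dFk; exact: subset_itv_oo_cc xlr.
  - apply: continuous_in_subspaceT => y; rewrite inE/= in_itv/= => /andP[ry yl].
    have := F_oo _ (rseq_oo k ab); have := F_oo _ (lseq_oo k ab).
    rewrite !in_itv/= => /andP[_ lFa] /andP[Fbr _].
    apply: cG.
    by rewrite in_itv/= (lt_le_trans Fbr)//= (le_lt_trans yl).
  by apply: eq_integral => x; rewrite inE/= => /lrab xab; rewrite !fctE/= F'f.
have intG : (\int[mu]_(y in `[F (r k), F (l k)]) (G y)%:E)%E
    @[k --> \oo] --> (\int[mu]_(y in `]F b, F a[) (G y)%:E)%E.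
  apply: segment_exhaustion_cvg.
  - by move=> m n mn; rewrite F_le ?rseq_oo//; exact: rseq_nondec.
  - by move=> m n mn; rewrite F_le ?lseq_oo//; exact: lseq_noninc.
  - apply/seteqP; split => y.
      move=> [k _]/=; rewrite !in_itv/= => /andP[ry yl].
      have := F_oo _ (rseq_oo k ab); have := F_oo _ (lseq_oo k ab).
      rewrite !in_itv/= => /andP[_ lFa] /andP[Fbr _].
      by rewrite (lt_le_trans Fbr)//= (le_lt_trans yl).
    rewrite /= in_itv/= => /andP[Fby yFa].
    have [x xab Fxy] : exists2 c, c \in `[a, b] & F c = y.
      apply: IVT => //; first exact: ltW.
      by rewrite ge_min le_max (ltW yFa) (ltW Fby) orbT.
    have {}xab : x \in `]a, b[.
      move: xab; rewrite !in_itv/= => /andP[ax xb]; rewrite !lt_neqAle ax xb.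
      by rewrite !andbT; apply/andP; split; apply/eqP => E; move: Fby yFa;
        rewrite -Fxy E ltxx.
    have : (\bigcup_k `[l k, r k]%classic) x by rewrite lrseq_bigcup.
    move=> [k _]; rewrite /= in_itv/= => /andP[lx xr].
    by exists k => //=; rewrite in_itv/= -Fxy !F_le// ?rseq_oo ?lseq_oo.
  - exact: interval_open.
  - by move=> x; rewrite inE => /cG.
  - by move=> x /G_ge0.
have intGF : (\int[mu]_(x in `[l k, r k]) (G (F x) * - f x)%:E)%E
    @[k --> \oo] --> (\int[mu]_(x in `]a, b[) (G (F x) * - f x)%:E)%E.
  apply: segment_exhaustion_cvg.
  - exact: lseq_noninc.
  - exact: rseq_nondec.
  - exact: lrseq_bigcup.
  - exact: interval_open.
  - move=> x; rewrite inE/= => xab; apply: (@continuousM _ _ (G \o F) (- f)).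
      by apply: continuous_comp; [exact: cFx|exact/cG/F_oo].
    by apply: continuousN; exact: cf.
  - by move=> x /= xab; rewrite mulr_ge0 ?oppr_ge0 ?f_le0//; exact/G_ge0/F_oo.
apply: (cvg_unique _ intG) => //.
rewrite [X in X @ _](_ : _ = fun k =>
  (\int[mu]_(x in `[l k, r k]) (G (F x) * - f x)%:E)%E)//.
by apply/funext => k; rewrite seg_int.
Unshelve. all: by end_near. Qed.

End exhaustion.

(** * The recurrence of the Gamma function *)

Section gamma_function.
Context {R : realType}.
Notation mu := (@lebesgue_measure R).

(** Infinite values are harmless because [fine] sends them to 0, so identities
    between extended integrals descend to real-valued ones. *)
Lemma fineZl (c : R) (x : \bar R) : 0 < c -> fine (c%:E * x) = c * fine x.
Proof.
move=> c0; case: x => [r| |] //=.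
  by rewrite gt0_muley ?lte_fin//= mulr0.
by rewrite gt0_muleNy ?lte_fin//= mulr0.
Qed.

Lemma continuous_powR (a x : R) : 0 < x -> {for x, continuous (@powR R ^~ a)}.
Proof.
move=> x0; apply/differentiable_continuous/derivable1_diffP.
by apply: derivable_powR; rewrite in_itv/= x0.
Qed.

(** From [t <= exp t] at [t = v / (2 x)], hence [v ^ x <= (2 x) ^ x * exp (v / 2)];
    half of the exponential is left to give the decay in [1 / v]. *)
Lemma powR_expRN_le (x v : R) : 0 < x -> 0 < v ->
  v `^ x * expR (- v) <= (2 * x) `^ x * 2 * v^-1.
Proof.
move=> x0 v0.
have x20 : 0 < 2 * x by rewrite mulr_gt0.
have vx : v `^ x <= (2 * x) `^ x * expR (v / 2).
  have -> : expR (v / 2) = expR (v / (2 * x)) `^ x.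
    by rewrite -expRM; congr expR; field; rewrite gt_eqF.
  rewrite -powRM ?expR_ge0 ?(ltW x20)//.
  have vE : v <= 2 * x * expR (v / (2 * x)).
    rewrite -ler_pdivrMl// mulrC.
    by apply: le_trans (expR_ge1Dx _); rewrite lerDr.
  apply: ge0_ler_powR => //; rewrite ?nnegrE ?(ltW v0) ?ltW//.
  exact: lt_le_trans vE.
apply: (@le_trans _ _ ((2 * x) `^ x * expR (v / 2) * expR (- v))).
  by rewrite ler_wpM2r ?expR_ge0.
rewrite -!mulrA ler_wpM2l ?powR_ge0// -expRD.
rewrite (_ : v / 2 - v = - (v / 2)); last by field.
rewrite expRN -[2 / v]invf_div lef_pV2 ?posrE ?expR_gt0 ?divr_gt0//.
by apply: le_trans (expR_ge1Dx _); rewrite lerDr.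
Qed.

Lemma Gamma_ge0 (x : R) : 0 <= Gamma x.
Proof.
by apply: Rintegral_ge0 => t _; rewrite mulr_ge0 ?powR_ge0 ?expR_ge0.
Qed.

Lemma bigcup_invn_itv :
  \bigcup_k `[(k.+2%:R : R)^-1, k.+2%:R]%classic = `]0, +oo[%classic.
Proof.
apply/seteqP; split => x /=.
  move=> [k _]/=; rewrite !in_itv/= andbT => /andP[kx _].
  by apply: lt_le_trans kx.
rewrite in_itv/= andbT => x0.
pose k := Num.truncn (x + x^-1); exists k => //=.
have xx0 : 0 <= x + x^-1 by rewrite addr_ge0// ?invr_ge0 ltW.
have kx : x + x^-1 < k.+2%:R.
  by apply: lt_trans (truncnS_gt _) _; rewrite ltr_nat.
rewrite in_itv/= (le_trans _ (ltW kx)) ?lerDl ?invr_ge0 ?(ltW x0)// andbT.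
rewrite invf_ple ?posrE// (le_trans _ (ltW kx))// lerDr ltW//.
Qed.

(** Integration by parts on the segments [1/(k+2), k+2], then [k] goes to
    infinity: the integrals converge by monotonicity, and the boundary terms
    vanish at 0 because [x > 0] and at infinity by [powR_expRN_le]. *)
Lemma GammaD1 (x : R) : 0 < x -> Gamma (x + 1) = x * Gamma x.
Proof.
move=> x0; rewrite /Gamma /Rintegral -fineZl//; congr fine.
pose g (y t : R) := t `^ (y - 1) * expR (- t).
pose u k := (k.+2%:R : R)^-1; pose v k : R := k.+2%:R.
have cE t : {for t, continuous (fun t : R => expR (- t))}.
  apply: (@continuous_comp _ _ _ (fun t : R => - t) expR).
    exact: continuousN.
  exact: continuous_expR.
have cg y t : 0 < t -> {for t, continuous (g y)}.
  move=> t0; apply: continuousM; first exact: continuous_powR.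
  exact: cE.
have cvg_seg y : (\int[mu]_(t in `[u k, v k]) (g y t)%:E)%E @[k --> \oo] -->
    (\int[mu]_(t in `]0%R, +oo[) (g y t)%:E)%E.
  apply: segment_exhaustion_cvg.
  - by move=> m n mn; rewrite /u lef_pV2 ?posrE// ler_nat !ltnS.
  - by move=> m n mn; rewrite /v ler_nat !ltnS.
  - exact: bigcup_invn_itv.
  - exact: interval_open.
  - by move=> t; rewrite inE/= in_itv/= andbT => /(cg y).
  - by move=> t _; rewrite mulr_ge0 ?powR_ge0 ?expR_ge0.
pose b t := t `^ x * expR (- t).
have parts k : (\int[mu]_(t in `[u k, v k]) (g (x + 1) t)%:E =
   (b (u k) - b (v k))%:E + x%:E * \int[mu]_(t in `[u k, v k]) (g x t)%:E)%E.
  have u0 : 0 < u k by rewrite invr_gt0.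
  have uv : u k < v k.
    by rewrite (@lt_trans _ _ 1)// ?invf_lt1// ltr1n.
  have pos t : t \in `[u k, v k] -> 0 < t.
    by rewrite in_itv/= => /andP[ut _]; exact: lt_le_trans ut.
  transitivity (\int[mu]_(t in `[u k, v k]) (t `^ x * expR (- t))%:E)%E.
    by apply: eq_integral => t _; rewrite /g addrK.
  have dP (t : R) : 0 < t -> is_derive t 1 (@powR R ^~ x) (x * t `^ (x - 1)).
    exact: is_derive1_powR.
  have dE (t : R) : is_derive t 1 (fun t : R => - expR (- t)) (expR (- t)).
    rewrite -[X in is_derive _ _ _ X]opprK; apply: is_deriveN.
    rewrite -mulrN1.
    exact: (is_derive1_comp (is_derive_expR _) (is_deriveNid t 1)).
  have cP : {within `[u k, v k], continuous (fun t : R => x * t `^ (x - 1))}.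
    apply: continuous_in_subspaceT => t; rewrite inE => /pos t0.
    by apply: cvgMr; exact: continuous_powR.
  have lr (F f : R -> R) : (forall t : R, 0 < t -> is_derive t 1 F (f t)) ->
      derivable_oo_LRcontinuous F (u k) (v k) /\ {in `]u k, v k[, derive1 F =1 f}.
    move=> dF; have dFuv t : t \in `[u k, v k] -> derivable F t 1.
      by move=> /pos/dF[].
    have [_ Fl Fr] : [/\ {in `]u k, v k[, continuous F},
        F x @[x --> (u k)^'+] --> F (u k) & F x @[x --> (v k)^'-] --> F (v k)].
      exact/(continuous_within_itvP _ uv)/derivable_within_continuous.
    split; first by split => // t /subset_itv_oo_cc/dFuv.
    by move=> t /subset_itv_oo_cc/pos/dF dFt; rewrite derive1E; exact: derive_val.
  rewrite (@integration_by_parts _ (@powR R ^~ x) (fun t => - expR (- t))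
    (fun t => x * t `^ (x - 1)) (fun t => expR (- t))) //; last 5 first.
  - exact: (lr _ _ dP).1.
  - exact: (lr _ _ dP).2.
  - by apply: continuous_subspaceT => t; exact: cE.
  - by apply: (lr _ (fun t => expR (- t)) _).1 => t _; exact: dE.
  - by apply: (lr _ _ _).2 => t _; exact: dE.
  rewrite (_ : (\int[mu]_(t in `[u k, v k])
      (x * t `^ (x - 1) * - expR (- t))%:E)%E =
    ((- x)%:E * \int[mu]_(t in `[u k, v k]) (g x t)%:E)%E).
    rewrite EFinN mulNe oppeK; congr (_%:E + _)%E.
    by rewrite /b !mulrN opprK addrC.
  rewrite -integralZl//.
    by apply: eq_integral => t _; rewrite -EFinM /g mulrN mulNr mulrA.
  apply: continuous_compact_integrable; first exact: segment_compact.
  by apply: continuous_in_subspaceT => t; rewrite inE => /pos /(cg x).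
have uE : u = fun k => harmonic (k + 1)%N.
  by apply/funext => k; rewrite /u/harmonic/= addn1.
have cu : u k @[k --> \oo] --> (0 : R).
  have := @cvg_harmonic R; rewrite -(cvg_shiftn 1)/= uE; exact.
have bu : b (u k) @[k --> \oo] --> 0.
  rewrite -[X in _ --> X](mul0r (expR (- 0))); apply: cvgM.
    have /cvg_at_rightP := powR_cvg0 x0; apply; split => // k.
    by rewrite invr_gt0.
  exact: (cvg_comp _ _ cu (cE 0)).
have bv : b (v k) @[k --> \oo] --> 0.
  have ub : ((2 * x) `^ x * 2) * u k @[k --> \oo] --> 0.
    by rewrite -[X in _ --> X](mulr0 ((2 * x) `^ x * 2)); apply: cvgMr.
  apply: (squeeze_cvgr _ (cvg_cst 0) ub); apply: nearW => k.
  by rewrite mulr_ge0 ?powR_ge0 ?expR_ge0//= powR_expRN_le.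
have lim : (\int[mu]_(t in `[u k, v k]) (g (x + 1) t)%:E)%E @[k --> \oo] -->
    (x%:E * \int[mu]_(t in `]0%R, +oo[) (g x t)%:E)%E.
  rewrite (funext parts) -[X in _ --> X]add0e; apply: cvgeD.
  - by [].
  - apply: cvg_EFin; first exact: nearW.
    by rewrite -[X in _ --> X](subr0 0); apply: cvgB.
  - exact: cvgeZl.
exact: (cvg_unique _ (cvg_seg (x + 1)) lim).
Qed.
End gamma_function.

(** * The singular weight *)

Section weight.
Context {R : realType}.
Notation mu := (@lebesgue_measure R).
Variable alpha : R.
Hypotheses (alpha_gt0 : 0 < alpha) (alpha_lt1 : alpha < 1).
Implicit Types (f g : R -> R) (p q s C eps : R).

Definition weight s := (1 - s) `^ (- alpha).

Lemma weight_ge0 s : 0 <= weight s. Proof. exact: powR_ge0. Qed.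

Lemma continuous_weight s : s < 1 -> {for s, continuous weight}.
Proof.
move=> s1; apply: (@continuous_comp _ _ _ (fun s => 1 - s)
  (fun t => t `^ (- alpha))).
  by apply: continuousB; [exact: cst_continuous|].
by apply: continuous_powR; rewrite subr_gt0.
Qed.

Lemma integral_weight p : p < 1 ->
  (\int[mu]_(s in `]p, 1%R[) (weight s)%:E =
   ((1 - p) `^ (1 - alpha) / (1 - alpha))%:E)%E.
Proof.
move=> p1; have a1 : 0 < 1 - alpha by rewrite subr_gt0.
pose F s := - ((1 - s) `^ (1 - alpha) / (1 - alpha)).
have dF s : s < 1 -> is_derive s 1 F (weight s).
  move=> s1; have s1' : 0 < 1 - s by rewrite subr_gt0.
  have dsub : is_derive s 1 (fun s : R => 1 - s) (0 - 1).
    by apply: is_deriveB.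
  have dpow := @is_derive1_comp _ (@powR R ^~ (1 - alpha)) (fun s => 1 - s)
    s _ _ (is_derive1_powR (1 - alpha) s1') dsub.
  rewrite (_ : F = - ((1 - alpha)^-1 *: ((@powR R ^~ (1 - alpha)) \o (fun s => 1 - s)))).
    apply: is_derive_eq.
    rewrite /weight sub0r mulrN1 scalerN opprK /GRing.scale/= mulKf ?gt_eqF//.
    by congr (_ `^ _); ring.
  by apply/funext => t; rewrite /F !fctE /GRing.scale/= mulrC.
have cF s : s < 1 -> {for s, continuous F}.
  by move=> /dF[dFs _]; exact/differentiable_continuous/derivable1_diffP.
rewrite (@ge0_continuous_FTC2_oo _ weight F)//.
- congr EFin; rewrite /F subrr powR0 ?gt_eqF// mul0r oppr0 sub0r opprK//.
- by move=> s _; exact: weight_ge0.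
- by move=> s; rewrite in_itv/= => /andP[_ /continuous_weight].
- by move=> s; rewrite in_itv/= => /andP[_ /dF].
apply/(continuous_within_itvP _ p1); split.
- by move=> s; rewrite in_itv/= => /andP[_ /cF].
- exact/cvg_at_right_filter/cF.
apply/cvg_at_leftP => u [u_lt u_cvg].
rewrite /F subrr powR0 ?gt_eqF//; apply: cvgN; apply: cvgMl.
have /cvg_at_rightP/(_ (fun n => 1 - u n)) := powR_cvg0 a1; apply; split.
  by move=> n; rewrite subr_gt0.
rewrite -[X in _ --> X](subrr 1); apply: cvgB => //; exact: cvg_cst.
Qed.

Lemma integrable_weight p q : p < 1 -> q <= 1 ->
  mu.-integrable `]p, q[ (EFin \o weight).
Proof.
move=> p1 q1.
have int1 : mu.-integrable `]p, 1%R[ (EFin \o weight).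
  apply/integrableP; split.
    apply/measurable_EFinP; apply: open_continuous_measurable_fun => [|s].
      exact: interval_open.
    by rewrite inE/= in_itv/= => /andP[_ /continuous_weight].
  under eq_integral do rewrite /= ger0_norm ?weight_ge0//.
  by rewrite integral_weight// ltry.
by apply: integrableS int1 => //; apply: subset_itvl; rewrite bnd_simp.
Qed.

Lemma integrable_weightM p q f C : p < 1 -> q <= 1 ->
  {in `]p, q[, continuous f} -> {in `]p, q[, forall s, `|f s| <= C} ->
  mu.-integrable `]p, q[ (fun s => (weight s * f s)%:E).
Proof.
move=> p1 q1 cf fC.
have iCw : mu.-integrable `]p, q[ (fun s => C%:E * (weight s)%:E)%E.
  by apply: integrableZl => //; exact: integrable_weight.
apply: (le_integrable _ _ _ iCw) => //.
- apply/measurable_EFinP; apply: open_continuous_measurable_fun => [|s].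
      exact: interval_open.
  rewrite inE/= => spq; apply: continuousM; last exact: cf.
  apply: continuous_weight; move: spq.
  by rewrite in_itv/= => /andP[_ /lt_le_trans]; exact.
- move=> s /= /fC fsC; rewrite lee_fin !normrM mulrC ler_wpM2r//.
  by rewrite (le_trans fsC)// ler_norm.
Qed.

Lemma dist_Rintegral_weight p q f g C eps : p < 1 -> q <= 1 ->
  {in `]p, q[, continuous f} -> {in `]p, q[, continuous g} ->
  {in `]p, q[, forall s, `|f s| <= C} ->
  {in `]p, q[, forall s, `|f s - g s| <= eps} ->
  `|\int[mu]_(s in `]p, q[) (weight s * f s) -
    \int[mu]_(s in `]p, q[) (weight s * g s)| <=
  eps * \int[mu]_(s in `]p, q[) weight s.
Proof.
move=> p1 q1 cf cg fC fg.
have if_ := integrable_weightM p1 q1 cf fC.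
have gC : {in `]p, q[, forall s, `|g s| <= C + eps}.
  move=> s spq; rewrite -[g s](subKr (f s)) (le_trans (ler_normB _ _))//.
  by rewrite lerD ?fC ?fg.
have ig := integrable_weightM p1 q1 cg gC.
have iw := integrable_weight p1 q1.
have ifg : mu.-integrable `]p, q[ (EFin \o (fun s => weight s * f s - weight s * g s)).
  rewrite (_ : _ \o _ = fun s => (weight s * f s)%:E - (weight s * g s)%:E)%E//.
  exact: integrableB.
rewrite -RintegralB//; apply: le_trans (le_normr_Rintegral _ ifg) _ => //.
rewrite -RintegralZl//; apply: le_Rintegral => //.
- by rewrite (_ : _ \o _ = fun s => `|(weight s * f s - weight s * g s)%:E|)%E//;
    exact: integrable_abse.
- rewrite (_ : _ \o _ = fun s => eps%:E * (weight s)%:E)%E//.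
  exact: integrableZl.
- move=> s /fg fgs; rewrite -mulrBr normrM ger0_norm ?weight_ge0// mulrC.
  by rewrite ler_wpM2r ?weight_ge0.
Qed.

Lemma Rintegral_weight p : p < 1 ->
  \int[mu]_(s in `]p, 1[) weight s = (1 - p) `^ (1 - alpha) / (1 - alpha).
Proof. by move=> p1; rewrite /Rintegral integral_weight. Qed.

Lemma Rintegral_oo_split p q r f : p < q -> q <= r ->
  mu.-integrable `]p, r[ (EFin \o f) ->
  \int[mu]_(s in `]p, r[) f s =
  \int[mu]_(s in `]p, q[) f s + \int[mu]_(s in `]q, r[) f s.
Proof.
move=> pq; rewrite le_eqVlt => /predU1P[<- _|qr intf].
  by rewrite [X in _ + X](_ : _ = 0) ?addr0// set_itvoo0 Rintegral_set0.
have := @Rintegral_itvB _ f (BRight p) (BLeft r) q intf.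
rewrite !bnd_simp => /(_ (ltW pq) qr) <-.
have intpq : mu.-integrable `]p, q[ (EFin \o f).
  by apply: integrableS intf => //; apply: subset_itvl; rewrite bnd_simp ltW.
by rewrite (Rintegral_itv_bndo_bndc intpq) addrCA subrr addr0.
Qed.

(** The mass is [(1 - (1 - x) ^ (1 - alpha)) / (1 - alpha)], and
    [1 - x <= (1 - x) ^ (1 - alpha)] since [1 - x] is at most 1. *)
Lemma Rintegral_weight_0x (x : R) : 0 < x -> x <= 1 ->
  \int[mu]_(s in `]0, x[) weight s <= x / (1 - alpha).
Proof.
move=> x0 x1.
have a1 : 0 < 1 - alpha by rewrite subr_gt0.
have := @Rintegral_oo_split 0 x 1 weight x0 x1 (integrable_weight ltr01 (lexx 1)).
rewrite Rintegral_weight// subr0 powR1 => E.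
have -> : \int[mu]_(s in `]0, x[) weight s =
    (1 - (1 - x) `^ (1 - alpha)) / (1 - alpha).
  move: x1; rewrite le_eqVlt => /predU1P[x1|x1].
    by rewrite x1 Rintegral_weight// !subr0 powR1 subrr powR0 ?gt_eqF// subr0.
  by move: E; rewrite Rintegral_weight// mulrBl => ->; rewrite addrK.
rewrite ler_wpM2r ?invr_ge0 ?(ltW a1)// lerBlDr -lerBlDl.
move: x1; rewrite le_eqVlt => /predU1P[->|x1].
  by rewrite subrr powR_ge0.
apply: ger1_powR; last by rewrite gerBl ltW.
by rewrite subr_gt0 x1 gerBl ltW.
Qed.

End weight.

(** * The substitution between cells and the unit interval *)

Section change_of_variables.
Context {R : realType}.
Notation mu := (@lebesgue_measure R).
Variables (alpha B eta : R).
Hypotheses (alpha_gt0 : 0 < alpha) (alpha_lt1 : alpha < 1).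
Hypotheses (B_gt0 : 0 < B) (eta_gt0 : 0 < eta).
Implicit Types (P : R -> R) (a b s z : R).

Definition to_s z := (z / eta) `^ (- B^-1).
Definition to_z s := s `^ (- B) * eta.

Lemma ltr_powRN (c x y : R) : 0 < c -> 0 < x -> x < y -> y `^ (- c) < x `^ (- c).
Proof.
move=> c0 x0 xy; have y0 := lt_trans x0 xy.
rewrite !powRN ltf_pV2 ?posrE ?powR_gt0//.
by apply: gt0_ltr_powR => //; rewrite nnegrE ltW.
Qed.

Lemma to_s_gt0 z : 0 < z -> 0 < to_s z.
Proof. by move=> z0; rewrite powR_gt0// divr_gt0. Qed.

Lemma to_z_gt0 s : 0 < s -> 0 < to_z s.
Proof. by move=> s0; rewrite mulr_gt0// powR_gt0. Qed.

Lemma to_s_decr a b : 0 < a -> a < b -> to_s b < to_s a.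
Proof.
move=> a0 ab; apply: ltr_powRN; rewrite ?invr_gt0 ?divr_gt0//.
by rewrite ltr_pM2r// invr_gt0.
Qed.

Lemma to_z_decr a b : 0 < a -> a < b -> to_z b < to_z a.
Proof. by move=> a0 ab; rewrite ltr_pM2r//; exact: ltr_powRN. Qed.

Lemma to_sK z : 0 < z -> to_z (to_s z) = z.
Proof.
move=> z0; rewrite /to_z /to_s -powRrM mulrNN mulVf ?gt_eqF// powRr1.
  by rewrite divfK// gt_eqF.
by rewrite ltW// divr_gt0.
Qed.

Lemma to_s_eta : to_s eta = 1.
Proof. by rewrite /to_s divff ?gt_eqF// powR1. Qed.

Lemma to_z_oo a b s : 0 < a -> 0 < b -> s \in `]to_s b, to_s a[ ->
  to_z s \in `]a, b[.
Proof.
move=> a0 b0; rewrite !in_itv/= => /andP[bs sa].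
have s0 : 0 < s := lt_trans (to_s_gt0 b0) bs.
by rewrite -(to_sK a0) -(to_sK b0) !to_z_decr// to_s_gt0.
Qed.

Lemma continuous_to_z s : 0 < s -> {for s, continuous to_z}.
Proof. by move=> s0; apply: cvgMl; exact: continuous_powR. Qed.

(** The derivative of [to_s]. *)
Definition dto_s z := B^-1 * - (z / eta) `^ (- B^-1 - 1) * eta^-1.

Lemma is_derive_to_s z : 0 < z -> is_derive z 1 to_s (dto_s z).
Proof.
move=> z0; have ze0 : 0 < z / eta by rewrite divr_gt0.
have dlin : is_derive z 1 (fun z : R => z / eta) (eta^-1).
  rewrite (_ : (fun z : R => z / eta) = eta^-1 *: id).
    by apply: is_derive_eq; rewrite /GRing.scale/= mulr1.
  by apply/funext => t; rewrite !fctE /GRing.scale/= mulrC.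
have := @is_derive1_comp _ (@powR R ^~ (- B^-1)) (fun z => z / eta)
  z _ _ (is_derive1_powR (- B^-1) ze0) dlin.
by rewrite /dto_s mulrN mulNr.
Qed.

Lemma weight_to_s z : eta < z ->
  weight alpha (to_s z) * - dto_s z = eta `^ ((1 - alpha) / B) / B *
    ((eta `^ (- B^-1) - z `^ (- B^-1)) `^ (- alpha) * z `^ (- B^-1 - 1)).
Proof.
move=> ez; have z0 := lt_trans eta_gt0 ez.
have powV c : (z / eta) `^ (- c) = z `^ (- c) * eta `^ c.
  rewrite powRM ?invr_ge0 ?ltW//; congr (_ * _).
  by rewrite -powR_inv1 ?ltW// -powRrM mulN1r opprK.
have eta1 : eta `^ (- B^-1) * eta `^ B^-1 = 1.
  by rewrite powRN mulVf// gt_eqF// powR_gt0.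
have D0 : 0 <= eta `^ (- B^-1) - z `^ (- B^-1).
  by rewrite subr_ge0 ltW// ltr_powRN// invr_gt0.
rewrite /weight /to_s /dto_s -opprD !powV -[X in X - _]eta1 -mulrBl.
rewrite powRM ?powR_ge0// -powRrM.
rewrite (_ : eta `^ (B^-1 + 1) = eta `^ B^-1 * eta); last first.
  by rewrite powRD ?powRr1 ?(ltW eta_gt0)// (gt_eqF eta_gt0) implybT.
have -> : eta `^ ((1 - alpha) / B) = eta `^ (B^-1 * - alpha) * eta `^ B^-1.
  rewrite -powRD ?(gt_eqF eta_gt0) ?implybT//; congr (_ `^ _); ring.
by field; rewrite !gt_eqF.
Qed.

Lemma Rintegral_to_s P a b : eta <= a -> a < b ->
  {in `]a, b[, continuous P} -> {in `]a, b[, forall z, 0 <= P z} ->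
  \int[mu]_(s in `]to_s b, to_s a[) (weight alpha s * P (to_z s)) =
  eta `^ ((1 - alpha) / B) / B *
  \int[mu]_(z in `]a, b[)
    ((eta `^ (- B^-1) - z `^ (- B^-1)) `^ (- alpha) * z `^ (- B^-1 - 1) * P z).
Proof.
move=> ea ab cP P0.
have a0 := lt_le_trans eta_gt0 ea; have b0 := lt_trans a0 ab.
have c0 : 0 < eta `^ ((1 - alpha) / B) / B by rewrite divr_gt0// powR_gt0.
rewrite /Rintegral -fineZl//; congr fine.
have pos z : z \in `[a, b] -> 0 < z.
  by rewrite in_itv/= => /andP[az _]; exact: lt_le_trans az.
rewrite (@decreasing_ge0_substitution_oo _ to_s dto_s)//.
- rewrite -ge0_integralZl//=; last 3 first.
  + apply/measurable_EFinP; apply: open_continuous_measurable_fun.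
      exact: interval_open.
    move=> z; rewrite inE/= => zab.
    have z0 : 0 < z := pos _ (subset_itv_oo_cc zab).
    have ez : eta < z.
      by move: zab; rewrite in_itv/= => /andP[+ _]; exact: le_lt_trans.
    apply: cvgM; last exact: cP.
    apply: cvgM; last exact: continuous_powR.
    apply: (@continuous_comp _ _ _ (fun z => eta `^ (- B^-1) - z `^ (- B^-1))
      (fun t => t `^ (- alpha))).
      by apply: cvgB; [exact: cvg_cst|exact: continuous_powR].
    by apply: continuous_powR; rewrite subr_gt0 ltr_powRN ?invr_gt0.
  + by move=> z /P0 ?; rewrite lee_fin !mulr_ge0 ?powR_ge0.
  + by rewrite lee_fin ltW.
  apply: eq_integral => z; rewrite inE/= => zab; rewrite -EFinM; congr EFin.
  have z0 : 0 < z := pos _ (subset_itv_oo_cc zab).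
  have ez : eta < z.
    by move: zab; rewrite in_itv/= => /andP[+ _]; exact: le_lt_trans.
  by rewrite to_sK// mulrAC weight_to_s// !mulrA.
- by move=> x y /pos x0 /pos y0; exact: to_s_decr.
- by move=> z /subset_itv_oo_cc/pos; exact: is_derive_to_s.
- move=> z /subset_itv_oo_cc/pos z0.
  apply: cvgMl; apply: cvgMr; apply: cvgN.
  apply: (@continuous_comp _ _ _ (fun z => z / eta)
    (fun t => t `^ (- B^-1 - 1))); first exact: cvgMl.
  by apply: continuous_powR; rewrite divr_gt0.
- apply: derivable_within_continuous => z /pos z0.
  by case: (is_derive_to_s z0).
- move=> s sba; have zab := to_z_oo a0 b0 sba.
  have s0 : 0 < s.
    move: sba; rewrite in_itv/= => /andP[+ _]; apply: lt_trans.
    exact: to_s_gt0.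
  apply: cvgM.
    apply: continuous_weight.
    move: sba; rewrite in_itv/= => /andP[_ /lt_le_trans]; apply.
    have [<-|ae] := eqVneq eta a; first by rewrite to_s_eta.
    by rewrite -to_s_eta ltW// to_s_decr// lt_neqAle ae.
  by apply: continuous_comp; [exact: continuous_to_z|exact: cP].
- by move=> s /(to_z_oo a0 b0)/P0 ?; rewrite mulr_ge0 ?weight_ge0.
Qed.

End change_of_variables.

(** * Error of a nonnegative interpolatory quadrature *)

Section quadrature.
Context {R : realType}.
Notation mu := (@lebesgue_measure R).
Variables (alpha B h : R) (U : R -> R).
Hypotheses (alpha_gt0 : 0 < alpha) (alpha_lt1 : alpha < 1).
Hypotheses (B_gt0 : 0 < B) (h_gt0 : 0 < h).

Lemma node_gt0 i : (0 < i)%N -> 0 < node h i.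
Proof. by move=> i0; rewrite mulr_gt0// ltr0n. Qed.

Lemma ltr_node i : node h i < node h i.+1.
Proof. by rewrite ltr_pM2r// ltr_nat. Qed.

Lemma ler_node i j : (i <= j)%N -> node h i <= node h j.
Proof. by move=> ij; rewrite ler_pM2r// ler_nat. Qed.

Lemma Gamma2B : Gamma (2 - alpha) = (1 - alpha) * Gamma (1 - alpha).
Proof. by rewrite -GammaD1 ?subr_gt0//; congr Gamma; ring. Qed.

(** At the origin the integrand is a constant multiple of the weight. *)
Lemma EK0 : EK alpha B U 0 = U 0 / Gamma (2 - alpha).
Proof.
rewrite /EK Gamma2B.
under eq_Rintegral do rewrite mulr0 mulrC.
rewrite RintegralZl//; last exact: integrable_weight.
rewrite Rintegral_weight// subr0 powR1 invfM; ring.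
Qed.

Variable Pi : R -> (R -> R) -> nat -> R -> R.
Variables (n N : nat) (C M eps : R).
Hypotheses (n_gt0 : (0 < n)%N) (nN : (n <= N)%N).
Hypothesis U_cont : forall z, 0 < z -> {for z, continuous U}.
Hypothesis U_bound : forall z, 0 < z -> `|U z| <= C.
Hypothesis U_tail : forall z, node h N <= z -> `|U z| <= M.
Hypothesis Pi_cont : forall i z, (n <= i < N)%N ->
  z \in `]node h i, node h i.+1[ -> {for z, continuous (Pi h U i)}.
Hypothesis Pi_ge0 : forall i z, (n <= i < N)%N ->
  z \in `]node h i, node h i.+1[ -> 0 <= Pi h U i z.
Hypothesis Pi_err : forall i z, (n <= i < N)%N ->
  z \in `]node h i, node h i.+1[ -> `|U z - Pi h U i z| <= eps.

Let eta := node h n.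
Let eta_gt0 : 0 < eta. Proof. exact: node_gt0. Qed.
Let knot i := to_s B eta (node h i).
Let V s := U (to_z B eta s).
Let cell i := \int[mu]_(s in `]knot i.+1, knot i[)
  (weight alpha s * Pi h U i (to_z B eta s)).

Let knot_gt0 i : (n <= i)%N -> 0 < knot i.
Proof.
by move=> ni; apply: to_s_gt0 => //; apply: node_gt0; exact: leq_trans ni.
Qed.

Let knotS_lt i : (n <= i)%N -> knot i.+1 < knot i.
Proof.
move=> ni; apply: to_s_decr => //; last exact: ltr_node.
by apply: node_gt0; exact: leq_trans ni.
Qed.

Let knot_le1 i : (n <= i)%N -> knot i <= 1.
Proof.
move=> /subnK <-; elim: (i - n)%N => [|k IH].
  by rewrite add0n /knot to_s_eta.
by rewrite addSn (le_trans _ IH)// ltW// knotS_lt// leq_addl.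
Qed.

Let V_cont p q : 0 <= p -> {in `]p, q[, continuous V}.
Proof.
move=> p0 s; rewrite in_itv/= => /andP[ps _]; have s0 := le_lt_trans p0 ps.
apply: (@continuous_comp _ _ _ (to_z B eta) U); first exact: continuous_to_z.
by apply: U_cont; exact: to_z_gt0.
Qed.

Let V_bound p q : 0 <= p -> {in `]p, q[, forall s, `|V s| <= C}.
Proof.
move=> p0 s; rewrite in_itv/= => /andP[ps _].
by apply: U_bound; apply: to_z_gt0 => //; exact: le_lt_trans ps.
Qed.

Let cell_error i : (n <= i < N)%N ->
  `|\int[mu]_(s in `]knot i.+1, knot i[) (weight alpha s * V s) - cell i| <=
  eps * \int[mu]_(s in `]knot i.+1, knot i[) weight alpha s.
Proof.
move=> niN; have /andP[ni iN] := niN.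
have pos j : (n <= j)%N -> 0 < node h j.
  by move=> nj; apply: node_gt0; exact: leq_trans nj.
have zoo s : s \in `]knot i.+1, knot i[ ->
    to_z B eta s \in `]node h i, node h i.+1[.
  by apply: to_z_oo => //; apply: pos => //; exact: leqW.
apply: (@dist_Rintegral_weight _ _ _ _ _ _ _ C).
- by [].
- exact: lt_le_trans (knotS_lt ni) (knot_le1 ni).
- exact: knot_le1.
- by apply: V_cont; rewrite ltW// knot_gt0// leqW.
- move=> s sk; apply: (@continuous_comp _ _ _ (to_z B eta) (Pi h U i)).
    apply: continuous_to_z; move: sk; rewrite in_itv/= => /andP[+ _].
    by apply: lt_trans; rewrite knot_gt0// leqW.
  exact/(Pi_cont niN)/zoo.
- by apply: V_bound; rewrite ltW// knot_gt0// leqW.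
- by move=> s /zoo; exact: Pi_err.
Qed.

Let iV p : 0 <= p -> p < 1 ->
  mu.-integrable `]p, 1%R[ (EFin \o (fun s => weight alpha s * V s)).
Proof.
move=> p0 p1; apply: (@integrable_weightM _ _ _ _ _ _ C) => //.
exact: V_cont.
exact: V_bound.
Qed.

(** Induction on the number of cells, from [s = 1] (the first node) downwards. *)
Let cells_error m : (n <= m <= N)%N ->
  `|\int[mu]_(s in `]knot m, 1[) (weight alpha s * V s) -
    \sum_(n <= i < m) cell i| <=
  eps * \int[mu]_(s in `]knot m, 1[) weight alpha s.
Proof.
move=> /andP[/subnK <-]; elim: (m - n)%N => [|k IH] kN.
  rewrite add0n big_geq// subr0 /knot to_s_eta// set_itvoo0.
  by rewrite !Rintegral_set0 normr0 mulr0.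
have {}IH := IH (ltnW kN); rewrite addSn in kN *; set m' := (k + n)%N in kN IH *.
have nm : (n <= m')%N by rewrite leq_addl.
have m'lt1 : knot m'.+1 < 1 := lt_le_trans (knotS_lt nm) (knot_le1 nm).
have m'ge0 : 0 <= knot m'.+1 by rewrite ltW// knot_gt0// leqW.
have split_int f : mu.-integrable `]knot m'.+1, 1%R[ (EFin \o f) ->
    \int[mu]_(s in `]knot m'.+1, 1[) f s =
    \int[mu]_(s in `]knot m'.+1, knot m'[) f s + \int[mu]_(s in `]knot m', 1[) f s.
  by apply: Rintegral_oo_split; [exact: knotS_lt|exact: knot_le1].
rewrite (split_int _ (iV m'ge0 m'lt1)).
rewrite (split_int _ (integrable_weight alpha_lt1 m'lt1 (lexx 1))).
rewrite big_nat_recr; last exact: nm.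
rewrite mulrDr [X in _ - X]addrC opprD addrACA.
by rewrite (le_trans (ler_normD _ _))// lerD// cell_error// nm.
Qed.

(** Comparison of [V] with the zero function, the discretization beyond
    [node h N]. *)
Let tail_error :
  `|\int[mu]_(s in `]0, knot N[) (weight alpha s * V s)| <=
  M * (knot N / (1 - alpha)).
Proof.
have M0 : 0 <= M by apply: le_trans (U_tail (lexx _)).
have := @dist_Rintegral_weight _ alpha alpha_lt1 0 (knot N) V (cst 0) C M
  ltr01 (knot_le1 nN) (V_cont (lexx 0)) _ (V_bound (lexx 0)) _.
rewrite [X in _ - X](_ : _ = 0) ?subr0; last first.
  rewrite /Rintegral integral0_eq// => s _.
  by rewrite /= mulr0.
move=> /(_ _ _)/le_trans; apply.
- by move=> s _; exact: cst_continuous.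
- move=> s; rewrite in_itv/= => /andP[s0 sN]; rewrite subr0; apply: U_tail.
  have N0 : 0 < node h N by apply: node_gt0; exact: leq_trans nN.
  by rewrite -(to_sK B_gt0 eta_gt0 N0) ltW// to_z_decr.
- by rewrite ler_wpM2l// Rintegral_weight_0x// ?knot_gt0// knot_le1.
Qed.

(** The first term is the truncation error, the second the interpolation
    error; [eps] uniformly bounds the latter on the cells. Nonnegativity of the
    rule is what allows the change of variables on the singular cell. *)
Lemma quadrature_error : 0 <= eps ->
  `|EK alpha B U (node h n) - EK_discr Pi alpha B h N U n| <=
  (M * (N%:R / n%:R) `^ (- B^-1) + eps) / Gamma (2 - alpha).
Proof.
move=> eps0; have a1 : 0 < 1 - alpha by rewrite subr_gt0.
have -> : EK_discr Pi alpha B h N U n =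
    (Gamma (1 - alpha))^-1 * \sum_(n <= i < N) cell i.
  rewrite /EK_discr gtn_eqF// [in RHS](eq_big_nat _ _ (F2 := fun i =>
    eta `^ ((1 - alpha) / B) / B * \int[mu]_(z in `]node h i, node h i.+1[)
      ((eta `^ (- B^-1) - z `^ (- B^-1)) `^ (- alpha) * z `^ (- B^-1 - 1) *
        Pi h U i z))); last first.
    move=> i niN; apply: Rintegral_to_s => //.
    - by apply: ler_node; case/andP: niN.
    - exact: ltr_node.
    - by move=> z; exact: Pi_cont.
    - by move=> z; exact: Pi_ge0.
  by rewrite -mulr_sumr invfM; ring.
have -> : (N%:R / n%:R) `^ (- B^-1) = knot N.
  congr (_ `^ _); rewrite /eta /node; field.
  by rewrite gt_eqF// pnatr_eq0 -lt0n.
rewrite Gamma2B invfM mulrA [X in _ <= X]mulrC /EK -mulrBr normrM.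
rewrite ger0_norm ?invr_ge0 ?Gamma_ge0// ler_wpM2l ?invr_ge0 ?Gamma_ge0//.
have kN0 := knot_gt0 nN; have kN1 := knot_le1 nN.
have -> : \int[mu]_(s in `]0, 1[) ((1 - s) `^ (- alpha) * U (s `^ (- B) * node h n)) =
   \int[mu]_(s in `]0, knot N[) (weight alpha s * V s) +
   \int[mu]_(s in `]knot N, 1[) (weight alpha s * V s).
  by apply: Rintegral_oo_split => //; exact: iV.
rewrite -addrA mulrDl (le_trans (ler_normD _ _))// lerD//.
  by rewrite -mulrA tail_error.
have := @cells_error N; rewrite nN leqnn => /(_ isT) /le_trans; apply.
rewrite ler_wpM2l//.
move: kN1; rewrite le_eqVlt => /predU1P[->|kN1].
  by rewrite set_itvoo0 Rintegral_set0 invr_ge0 ltW.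
rewrite Rintegral_weight// ler_pdivrMr// mulVf ?gt_eqF//.
apply: (@le_trans _ _ (1 `^ (1 - alpha))); last by rewrite powR1.
have k1 : 1 - knot N <= 1 by rewrite gerBl ltW.
have k0 : 0 <= 1 - knot N by rewrite subr_ge0 ltW.
by apply: ge0_ler_powR; rewrite ?nnegrE// ltW.
Qed.

End quadrature.

(** * Interpolation errors on the positive half-line *)

Section one_sided_derivative.
Context {R : realType}.
Implicit Types (f : R -> R) (x a b : R).

(** Near a positive point the constraint to the half-line is vacuous, so the
    constrained difference quotient has the ordinary derivative as its limit. *)
Lemma is_derive_derive0y f x : 0 < x -> cvg (diff_quot0y f x) ->
  is_derive x 1 f (derive0y f x).
Proof.
move=> x0 cvf; apply/is_derive1_caratheodory.
exists (fun y => if y == x then derive0y f x else (f y - f x) / (y - x)).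
split; last by rewrite eqxx.
  move=> y; case: eqVneq => [->|yx]; first by rewrite !subrr mulr0.
  by rewrite divfK// subr_eq0.
apply/continuous_withinNx; rewrite eqxx.
apply: (@cvg_trans _ ((f y - f x) / (y - x) @[y --> x^'])).
  apply: near_eq_cvg; near=> y; rewrite ifN//.
  by near: y; exact: nbhs_dnbhs_neq.
move=> A Al.
have nA : \forall y \near x^', `[0, +oo[%classic y -> A ((f y - f x) / (y - x)).
  exact: (cvf _ Al).
have pos : \forall y \near x^', 0 < y by apply: nbhs_dnbhs; exact: lt_nbhsr.
suff H : \forall y \near x^', A ((f y - f x) / (y - x)) by exact: H.
near=> y.
have y0 : 0 < y by near: y; exact: pos.
have : `[0, +oo[%classic y -> A ((f y - f x) / (y - x)) by near: y; exact: nA.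
by apply; rewrite /= in_itv/= andbT ltW.
Unshelve. all: by end_near. Qed.

Lemma is_derive_continuous f x l : is_derive x 1 f l -> {for x, continuous f}.
Proof. by case=> df _; exact/differentiable_continuous/derivable1_diffP. Qed.

Lemma MVT_pos f df a b : 0 < a -> a < b ->
  (forall x : R, 0 < x -> is_derive x 1 f (df x)) ->
  exists2 c, c \in `]a, b[ & f b - f a = df c * (b - a).
Proof.
move=> a0 ab dF; apply: MVT => //.
  move=> x; rewrite in_itv/= => /andP[ax _]; apply: dF; exact: lt_trans ax.
apply: derivable_within_continuous => x; rewrite in_itv/= => /andP[ax _].
by case: (dF x (lt_le_trans a0 ax)).
Qed.

(** Two applications of the mean value theorem on either side of [z] write the
    error as [(z - a) (b - z) / (b - a) * (f' x1 - f' x2)] with [x1 < z < x2];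
    a third one, for [f'], leaves
    [D * (z - a) * (b - z) <= D * (b - a) ^ 2 / 4]. The constant 1/2 is thus not
    sharp. *)
Lemma linear_interpolation_error f df ddf a b z D : 0 < a -> a < z -> z < b ->
  (forall x : R, 0 < x -> is_derive x 1 f (df x)) ->
  (forall x : R, 0 < x -> is_derive x 1 df (ddf x)) ->
  {in `]a, b[, forall x, `|ddf x| <= D} ->
  `|f z - (f a + (f b - f a) / (b - a) * (z - a))| <= 2^-1 * D * (b - a) ^+ 2.
Proof.
move=> a0 az zb df1 df2 ddfD.
have [x1 + E1] := MVT_pos a0 az df1; rewrite in_itv/= => /andP[ax1 x1z].
have [x2 + E2] := MVT_pos (lt_trans a0 az) zb df1.
rewrite in_itv/= => /andP[zx2 x2b].
have [c + E3] := MVT_pos (lt_trans a0 ax1) (lt_trans x1z zx2) df2.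
rewrite in_itv/= => /andP[x1c cx2].
have Dc : `|ddf c| <= D.
  by apply: ddfD; rewrite in_itv/= (lt_trans ax1)//= (lt_trans cx2).
have D0 : 0 <= D := le_trans (normr_ge0 _) Dc.
have ba0 : 0 < b - a by rewrite subr_gt0 (lt_trans az).
have -> : f z - (f a + (f b - f a) / (b - a) * (z - a)) =
    - ((z - a) * (b - z)) * ((x2 - x1) / (b - a)) * ddf c.
  have -> : f b - f a = df x2 * (b - z) + df x1 * (z - a).
    by rewrite -E2 -E1; ring.
  have -> : f z = f a + df x1 * (z - a) by rewrite -E1; ring.
  have -> : - ((z - a) * (b - z)) * ((x2 - x1) / (b - a)) * ddf c =
     - ((z - a) * (b - z)) / (b - a) * (ddf c * (x2 - x1)) by ring.
  by rewrite -E3; field; rewrite gt_eqF.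
have q1 : 0 <= (z - a) * (b - z) by rewrite mulr_ge0 ?subr_ge0 ?ltW.
have q2 : (z - a) * (b - z) <= 2^-1 * (b - a) ^+ 2 by nra.
have q3 : `|(x2 - x1) / (b - a)| <= 1.
  have x12 : 0 <= x2 - x1 by rewrite subr_ge0 ltW// (lt_trans x1z).
  rewrite ger0_norm; last by rewrite divr_ge0// ltW.
  by rewrite ler_pdivrMr// mul1r; lra.
rewrite 2!normrM normrN (ger0_norm q1) [2^-1 * D * _]mulrAC ler_pM//.
  by rewrite mulr_ge0.
by rewrite -[leRHS]mulr1 ler_pM.
Qed.

End one_sided_derivative.

(** * Supremum norms *)

Section sup_norm.
Context {R : realType}.
Implicit Types (f : R -> R) (A : set R).

Lemma le_sup_norm A f C : (forall z, A z -> `|f z| <= C) ->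
  forall z, A z -> `|f z| <= sup_norm A f.
Proof.
move=> fC z Az; apply: ub_le_sup; last by exists z.
by exists C => _ [y Ay <-]; exact: fC.
Qed.

Lemma le_sup_norm_segment f (b : R) : {within `[0, +oo[, continuous f} ->
  forall z, 0 <= z <= b -> `|f z| <= sup_norm `[0, b] f.
Proof.
move=> cf z zb; have b0 : 0 <= b by case/andP: zb; exact: le_trans.
have cfb : {within `[0, b], continuous (fun x => `|f x|)}.
  have {}cf : {within `[0, b], continuous f}.
    apply: continuous_subspaceW cf => x /=; rewrite !in_itv/= andbT.
    by case/andP.
  by move=> x; apply: (cvg_comp _ _ (cf x)); exact: norm_continuous.
have [c _ fc] := EVT_max b0 cfb.
by apply: (@le_sup_norm _ _ `|f c|) => [y|] /=; [exact: fc|rewrite in_itv].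
Qed.

End sup_norm.

(** * Choice of the truncation ratio *)

Section truncation.
Context {R : realType}.
Implicit Types (f U : R -> R) (alpha B h : R).

Lemma C1_0y_is_derive f : C1_0y f ->
  forall x : R, 0 < x -> is_derive x 1 f (derive0y f x).
Proof. by move=> [cvf _] x x0; apply: is_derive_derive0y => //; exact/cvf/ltW. Qed.

(** If the supremum does not exist, [sup] is 0 by convention. *)
Lemma sup_norm_ge0 (A : set R) f : 0 <= sup_norm A f.
Proof.
rewrite /sup_norm; set E := [set _ | _ in _].
have [[[y [z Az _]] bE]|/sup_out->//] := pselect (has_sup E).
by apply: le_trans (normr_ge0 (f z)) _; apply: ub_le_sup => //; exists z.
Qed.

(** Applied to the truncation ratio [g = N / n], this makes the truncation error
    of order [c]. *)
Lemma powRN_inv_le_powR B h c (g : nat) : 0 < B -> 0 < h ->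
  h `^ (- (c * B)) <= g%:R -> (g%:R : R) `^ (- B^-1) <= h `^ c.
Proof.
move=> B0 h0 hg.
have hc0 : 0 < h `^ (- (c * B)) by rewrite powR_gt0.
have -> : h `^ c = (h `^ (- (c * B))) `^ (- B^-1).
  by rewrite -powRrM; congr (_ `^ _); field; rewrite gt_eqF.
rewrite [leLHS]powRN [leRHS]powRN lef_pV2 ?posrE ?powR_gt0//; last exact: lt_le_trans hg.
apply: ge0_ler_powR; rewrite ?nnegrE ?invr_ge0//; exact: ltW.
Qed.

Lemma ratio_node (g n : nat) : (0 < n)%N -> ((g * n)%N%:R / n%:R : R) = g%:R.
Proof. by move=> n0; rewrite natrM mulfK// pnatr_eq0 -lt0n. Qed.

End truncation.

(** * The error estimates *)

Theorem theorem3 (R : realType) (alpha B h : R) (U : R -> R)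
    (alpha_gt0 : 0 < alpha) (alpha_lt1 : alpha < 1)
    (B_def : B = alpha / 2) (h_gt0 : 0 < h)
    (U_ge0 : forall z, 0 <= z -> 0 <= U z)
    (U_bounded : [bounded U z | z in `[0, +oo[]) :
  (C1_0y U -> forall n : nat,
     let N := (gamma_rect B h * n)%N in
     `|EK alpha B U (node h n) - EK_discr rectangle alpha B h N U n| <=
     (sup_norm `[node h N, +oo[ U + sup_norm `[0, node h N] (derive0y U)) *
       (h / Gamma (2 - alpha)))
  /\
  (C2_0y U -> forall n : nat,
     let N := (gamma_trap B h * n)%N in
     `|EK alpha B U (node h n) - EK_discr trapezoid alpha B h N U n| <=
     (sup_norm `[node h N, +oo[ U +
        2^-1 * sup_norm `[0, node h N] (derive0y (derive0y U))) *
       (h ^+ 2 / Gamma (2 - alpha))).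
Proof.
have B_gt0 : 0 < B by rewrite B_def divr_gt0.
have [C UC] : exists C, forall z, 0 <= z -> `|U z| <= C.
  case: U_bounded => C [_ UC]; exists (C + 1) => z z0.
  by apply: UC; rewrite ?ltrDl//= in_itv/= z0.
have U_tail N z : node h N <= z -> `|U z| <= sup_norm `[node h N, +oo[ U.
  move=> Nz; apply: (@le_sup_norm _ _ _ C); last by rewrite /= in_itv/= Nz.
  move=> y; rewrite /= in_itv/= andbT => Ny; apply: UC.
  by apply: le_trans Ny; rewrite mulr_ge0 ?(ltW h_gt0).
have at0 Pi N : `|EK alpha B U (node h 0) - EK_discr Pi alpha B h N U 0| = 0.
  by rewrite /node mul0r EK0//= subrr normr0.
have Gi : 0 <= (Gamma (2 - alpha))^-1 by rewrite invr_ge0 Gamma_ge0.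
have node_pos n i : (0 < n)%N -> (n <= i)%N -> 0 < node h i.
  by move=> n0 ni; apply: node_gt0 => //; exact: leq_trans ni.
have cellN N i z : (i < N)%N -> z <= node h i.+1 -> z <= node h N.
  by move=> iN zi; apply: le_trans zi _; exact: ler_node.
split=> [C1U|[C1U C1U']] n; set N := (_ * n)%N => /=.
- have dU := C1_0y_is_derive C1U.
  set D := sup_norm `[0, _] _; set M := sup_norm _ U.
  have [->|n0] := posnP n.
    rewrite at0 mulr_ge0 ?addr_ge0 ?sup_norm_ge0//.
    by rewrite mulr_ge0// ltW.
  have nN : (n <= N)%N by rewrite leq_pmull.
  have D_bound z : 0 <= z -> z <= node h N -> `|derive0y U z| <= D.
    by move=> z0 zN; apply: le_sup_norm_segment; [exact: C1U.2|rewrite z0].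
  apply: (@le_trans _ _ ((M * (N%:R / n%:R) `^ (- B^-1) + D * h) / Gamma (2 - alpha))).
    apply: (@quadrature_error _ _ _ _ _ _ _ _ _ rectangle n N C) => //.
    + by move=> z /dU/is_derive_continuous.
    + by move=> z /ltW/UC.
    + exact: U_tail.
    + by move=> i z _ _; exact: cst_continuous.
    + by move=> i z _ _; rewrite U_ge0// mulr_ge0// ltW.
    + move=> i z /andP[ni iN]; rewrite in_itv/= => /andP[iz zi].
      have z0 : 0 < z := lt_trans (node_pos _ _ n0 ni) iz.
      have [c + E] := MVT_pos z0 zi dU; rewrite in_itv/= => /andP[zc ci].
      rewrite distrC /rectangle E normrM ler_pM//.
        apply: D_bound; first by rewrite ltW// (lt_trans z0).
        by apply: (cellN _ i) => //; exact: ltW.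
      rewrite ger0_norm ?subr_ge0 ?(ltW zi)//.
      rewrite lerBlDr -lerBlDl (le_trans _ (ltW iz))//.
      by rewrite /node -natr1 mulrDl mul1r addrK.
    + by rewrite mulr_ge0 ?sup_norm_ge0// ltW.
  rewrite mulrA ler_wpM2r// mulrDl lerD2r ler_wpM2l ?sup_norm_ge0//.
  rewrite ratio_node// -[leRHS]powRr1 ?(ltW h_gt0)//.
  by apply: powRN_inv_le_powR => //; rewrite mul1r ltW// truncnS_gt.
- have dU := C1_0y_is_derive C1U; have ddU := C1_0y_is_derive C1U'.
  set D := sup_norm `[0, _] _; set M := sup_norm _ U.
  have D0 : 0 <= 2^-1 * D by rewrite mulr_ge0 ?sup_norm_ge0.
  have [->|n0] := posnP n.
    rewrite at0 mulr_ge0 ?addr_ge0 ?sup_norm_ge0//.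
    by rewrite mulr_ge0// exprn_ge0 ?ltW.
  have nN : (n <= N)%N by rewrite leq_pmull.
  have D_bound z : 0 <= z -> z <= node h N -> `|derive0y (derive0y U) z| <= D.
    by move=> z0 zN; apply: le_sup_norm_segment; [exact: C1U'.2|rewrite z0].
  have nodeB i : node h i.+1 - node h i = h.
    by rewrite /node -natr1 mulrDl mul1r addrAC subrr add0r.
  apply: (@le_trans _ _ ((M * (N%:R / n%:R) `^ (- B^-1) +
      2^-1 * D * h ^+ 2) / Gamma (2 - alpha))).
    apply: (@quadrature_error _ _ _ _ _ _ _ _ _ trapezoid n N C) => //.
    + by move=> z /dU/is_derive_continuous.
    + by move=> z /ltW/UC.
    + exact: U_tail.
    + move=> i z _ _; apply: cvgD; first exact: cvg_cst.
      by apply: cvgMr; apply: cvgB => //; exact: cvg_cst.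
    + move=> i z /andP[ni _]; rewrite in_itv/= => /andP[iz zi].
      have i0 := node_pos _ _ n0 ni.
      rewrite /trapezoid.
      set a := node h i in iz i0 *; set b := node h i.+1 in zi *.
      (* On its cell the trapezoid is a convex combination of nodal values. *)
      have -> : U a + (U b - U a) / h * (z - a) =
          (U a * (h - (z - a)) + U b * (z - a)) / h.
        by field; rewrite gt_eqF.
      rewrite divr_ge0 ?(ltW h_gt0)// addr_ge0// mulr_ge0 ?U_ge0//.
      * exact: ltW.
      * by rewrite -(nodeB i) -/a -/b opprB addrA subrK subr_ge0 ltW.
      * by rewrite ltW// (lt_trans i0) ?(lt_trans iz).
      * by rewrite subr_ge0 ltW.
    + move=> i z /andP[ni iN]; rewrite in_itv/= => /andP[iz zi].
      have i0 := node_pos _ _ n0 ni.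
      have := @linear_interpolation_error _ _ _ _ _ _ _ D i0 iz zi dU ddU.
      rewrite nodeB; apply=> x; rewrite in_itv/= => /andP[ix xi]; apply: D_bound.
        by rewrite ltW// (lt_trans i0).
      by apply: (cellN _ i) => //; exact: ltW.
    + by rewrite mulr_ge0// exprn_ge0 ?ltW.
  rewrite mulrA ler_wpM2r// mulrDl lerD2r ler_wpM2l ?sup_norm_ge0//.
  rewrite ratio_node// -powR_mulrn ?(ltW h_gt0)//.
  by apply: powRN_inv_le_powR => //; rewrite ltW// truncnS_gt.
Qed.
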